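(* Any simple $\mathfrak{b}^{(1)}$-module $V$ is, up to parity change, isomorphic to $U\oplus G_{\frac12}U$, where $U$ is a simple $\mathfrak{b}^{(1)}_{\bar0}$-module. In particular, $V$ is one-dimensional if $G_{\frac12}U=0$.
   Context: All vector spaces are over $\mathbb{C}$. A module over a Lie superalgebra $L=L_{\bar0}\oplus L_{\bar1}$ is a $\mathbb{Z}_2$-graded vector space $V=V_{\bar0}\oplus V_{\bar1}$ with a bilinear action such that $x(yv)-(-1)^{|x||y|}y(xv)=[x,y]v$ for homogeneous $x,y\in L$, $v\in V$, and $L_iV_j\subseteq V_{i+j}$ for $i,j\in\mathbb{Z}_2$; submodules are $\mathbb{Z}_2$-graded. The parity change functor $\Pi$ interchanges the even and odd parts of a module; ''up to parity change'' means after possibly replacing $V$ by $\Pi(V)$. $\mathfrak{b}^{(1)}$ is the 3-dimensional Lie superalgebra with even part $\mathfrak{b}^{(1)}_{\bar0}=\mathbb{C}L_0\oplus\mathbb{C}L_1$, odd part $\mathfrak{b}^{(1)}_{\bar1}=\mathbb{C}G_{\frac12}$, and brackets $[L_0,L_1]=-L_1$, $[L_0,G_{\frac12}]=-\frac12G_{\frac12}$, $[L_1,G_{\frac12}]=0$, $[G_{\frac12},G_{\frac12}]=2L_1$. (It is the quotient of $\mathfrak{b}=\bigoplus_{i\ge0}\mathbb{C}L_i\oplus\bigoplus_{i\ge1}\mathbb{C}G_{i-\frac12}$, inside the Neveu-Schwarz algebra, by the ideal $\bigoplus_{m>1}\mathbb{C}L_m\oplus\bigoplus_{m>1}\mathbb{C}G_{m-\frac12}$.)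 ''$U\oplus G_{\frac12}U$'' denotes a $\mathfrak{b}^{(1)}$-module whose even part contains $U$ as a simple $\mathfrak{b}^{(1)}_{\bar0}$-submodule and whose underlying space is the direct sum of $U$ and its image $G_{\frac12}U$ under the action of $G_{\frac12}$. *)

(* Defs.v *)
From HB Require Import structures.
From mathcomp Require Import all_boot all_order all_algebra ring.
From mathcomp Require Import all_classical reals complex.

Set Implicit Arguments.
Unset Strict Implicit.
Unset Printing Implicit Defensive.

Import Order.TTheory GRing.Theory Num.Theory.

Local Open Scope classical_set_scope.
Local Open Scope ring_scope.

Definition is_subspace (K : numFieldType) (V : lmodType K) (A : set V) : Prop :=
  submod_closed [in A].

Definition is_direct_sum (K : numFieldType) (V : lmodType K) (A B : set V) : Prop :=
  forall v : V, exists! p : V * V, [/\ A p.1, B p.2 & v = p.1 + p.2].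

(* Z_2 is encoded as bool: false is the even parity, true the odd one, and
   addition is addb (+). *)
Record superspace (K : numFieldType) := Superspace {
  sspace_sort :> lmodType K;
  part : bool -> set sspace_sort;
  part_subspace : forall i, is_subspace (part i);
  part_direct : is_direct_sum (part false) (part true) }.

Record lieSuperalgebra (K : numFieldType) := LieSuperalgebra {
  lie_space :> superspace K;
  bracket : lie_space -> lie_space -> lie_space;
  bracket_bilinear : bilinear_for *:%R *:%R bracket;
  bracket_part : forall i j x y,
    part i x -> part j y -> part (i (+) j) (bracket x y);
  bracket_skew : forall i j x y, part i x -> part j y ->
    bracket x y = - ((-1) ^+ (i && j) *: bracket y x);
  bracket_jacobi : forall i j x y z, part i x -> part j y ->
    bracket x (bracket y z) =
    bracket (bracket x y) z + (-1) ^+ (i && j) *: bracket y (bracket x z) }.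

Record superModule (K : numFieldType) (L : lieSuperalgebra K) := SuperModule {
  mod_space :> superspace K;
  act : L -> mod_space -> mod_space;
  act_bilinear : bilinear_for *:%R *:%R act;
  act_part : forall i j x v,
    part i x -> part j v -> part (i (+) j) (act x v);
  act_bracket : forall i j x y v, part i x -> part j y ->
    act x (act y v) - (-1) ^+ (i && j) *: act y (act x v) =
    act (bracket x y) v }.

Definition stable_subspace (K : numFieldType) (L : lieSuperalgebra K)
    (V : superModule L) (S : set L) (W : set V) : Prop :=
  is_subspace W /\ forall x w, S x -> W w -> W (act x w).

Definition is_graded (K : numFieldType) (V : superspace K) (W : set V) : Prop :=
  forall w, W w -> exists w0 w1 : V,
    [/\ W w0 /\ part false w0, W w1 /\ part true w1 & w = w0 + w1].

Definition is_submodule (K : numFieldType) (L : lieSuperalgebra K)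
    (V : superModule L) (W : set V) : Prop :=
  is_graded W /\ stable_subspace [set: L] W.

Definition is_simple (K : numFieldType) (L : lieSuperalgebra K)
    (V : superModule L) : Prop :=
  [set: V] <> [set 0] /\
  forall W : set V, is_submodule W -> W = [set 0] \/ W = [set: V].

(* U is a simple module over the even part of L, for the restricted action.
   It is only used for U inside the even part of V, where every subspace is
   graded. *)
Definition is_simple_even_submodule (K : numFieldType) (L : lieSuperalgebra K)
    (V : superModule L) (U : set V) : Prop :=
  [/\ stable_subspace (part false) U, U <> [set 0] &
      forall W : set V, W `<=` U -> stable_subspace (part false) W ->
        W = [set 0] \/ W = U].

Definition isomorphic (K : numFieldType) (L : lieSuperalgebra K)
    (V W : superModule L) : Prop :=
  exists f : {linear V -> W},
    [/\ bijective f, forall i v, part i v -> part i (f v) &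
        forall x v, f (act x v) = act x (f v)].

Lemma parity_direct (K : numFieldType) (V : superspace K) :
  is_direct_sum (@part K V (~~ false)) (@part K V (~~ true)).
Proof.
move=> v; have [[a b] [[/= Aa Bb ->] uniq]] := part_direct v.
exists (b, a); split; first by split=> //=; rewrite addrC.
move=> [c d] [/= Bc Ad e].
by have [-> ->] : (a, b) = (d, c) by apply: uniq; split=> //=; rewrite e addrC.
Qed.

Definition parity_space (K : numFieldType) (V : superspace K) : superspace K :=
  @Superspace K V (fun i => part (~~ i)) (fun i => @part_subspace K V (~~ i))
    (@parity_direct K V).

Lemma parity_act_part (K : numFieldType) (L : lieSuperalgebra K)
    (V : superModule L) i j (x : L) (v : V) :
  part i x -> part (~~ j) v -> part (~~ (i (+) j)) (act x v).
Proof. by rewrite -addbN; exact: act_part. Qed.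

(* The parity change functor on objects: same space, same action, with even
   and odd parts interchanged. *)
Definition parity_change (K : numFieldType) (L : lieSuperalgebra K)
    (V : superModule L) : superModule L :=
  @SuperModule K L (parity_space V) (@act K L V) (act_bilinear V)
    (@parity_act_part K L V) (@act_bracket K L V).

Definition isomorphic_up_to_parity (K : numFieldType) (L : lieSuperalgebra K)
    (V W : superModule L) : Prop :=
  isomorphic V W \/ isomorphic (parity_change V) W.

Definition one_dimensional (K : numFieldType) (V : lmodType K) : Prop :=
  exists2 v : V, v != 0 & forall w : V, exists c : K, w = c *: v.

(* The Lie superalgebra b^(1). A row vector holds the coordinates in the basis
   (L_0, L_1, G_{1/2}). *)
Definition b1_L0 (K : numFieldType) : 'rV[K]_3 := delta_mx 0 0.
Definition b1_L1 (K : numFieldType) : 'rV[K]_3 := delta_mx 0 1.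
Definition b1_G (K : numFieldType) : 'rV[K]_3 := delta_mx 0 2%:R.

Definition b1_part (K : numFieldType) (i : bool) : set 'rV[K]_3 :=
  if i then [set x | exists c, x = c *: b1_G K]
  else [set x | exists a b, x = a *: b1_L0 K + b *: b1_L1 K].

Arguments b1_part : clear implicits.

(* Bilinear extension of the bracket; b1_bracketE below lists its values on
   the basis. *)
Definition b1_bracket (K : numFieldType) (x y : 'rV[K]_3) : 'rV[K]_3 :=
  (x 0 1 * y 0 0 - x 0 0 * y 0 1 + 2 * (x 0 2%:R * y 0 2%:R)) *: b1_L1 K
  + (2^-1 * (x 0 2%:R * y 0 0 - x 0 0 * y 0 2%:R)) *: b1_G K.

Lemma b1_bracketE (K : numFieldType) :
  let L0 := b1_L0 K in let L1 := b1_L1 K in let G := b1_G K in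
  [/\ [/\ b1_bracket L0 L0 = 0, b1_bracket L1 L1 = 0 & b1_bracket G G = 2 *: L1],
      [/\ b1_bracket L0 L1 = - L1, b1_bracket L0 G = - (2^-1 *: G) &
          b1_bracket L1 G = 0] &
      [/\ b1_bracket L1 L0 = L1, b1_bracket G L0 = 2^-1 *: G &
          b1_bracket G L1 = 0]].
Proof.
by split; split; apply/rowP => k; rewrite !mxE /=;
  case: k => [[|[|[|//]]]] ? /=; rewrite ?mulr1n ?mulr0n; field.
Qed.

Lemma b1_rowP (K : numFieldType) (x y : 'rV[K]_3) :
  [/\ x 0 0 = y 0 0, x 0 1 = y 0 1 & x 0 2%:R = y 0 2%:R] -> x = y.
Proof.
move=> [e0 e1 e2]; apply/rowP => -[[|[|[|//]]] lt].
- by rewrite (_ : Ordinal lt = 0) //; apply: val_inj.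
- by rewrite (_ : Ordinal lt = 1) //; apply: val_inj.
- by rewrite (_ : Ordinal lt = 2%:R) //; apply: val_inj.
Qed.

Lemma b1_partP (K : numFieldType) i (x : 'rV[K]_3) : b1_part K i x <->
  if i then x 0 0 = 0 /\ x 0 1 = 0 else x 0 2%:R = 0.
Proof.
case: i; split => /=.
- by move=> [c ->]; rewrite !mxE /= ?mulr0.
- move=> [e0 e1]; exists (x 0 2%:R); apply: b1_rowP.
  by rewrite !mxE /= e0 e1 !mulr0 mulr1.
- by move=> [a [b ->]]; rewrite !mxE /= !mulr0 addr0.
- move=> e; exists (x 0 0), (x 0 1); apply: b1_rowP.
  by rewrite !mxE /= e !mulr0 !mulr1 !addr0 add0r.
Qed.

Lemma b1_part_subspace (K : numFieldType) i : is_subspace (b1_part K i).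
Proof.
split; first by rewrite inE; apply/b1_partP; case: i; rewrite !mxE.
move=> a u v; rewrite !inE => /b1_partP + /b1_partP +.
move=> Hv Hu; apply/b1_partP; move: Hu Hv.
case: i => [[u0 u1] [v0 v1]|u2 v2]; rewrite !mxE.
- by rewrite u0 u1 v0 v1 mulr0 addr0.
- by rewrite u2 v2 mulr0 addr0.
Qed.

Lemma b1_part_direct (K : numFieldType) :
  is_direct_sum (b1_part K false) (b1_part K true).
Proof.
move=> v; exists (v 0 0 *: b1_L0 K + v 0 1 *: b1_L1 K, v 0 2%:R *: b1_G K).
split.
  split=> /=; [by exists (v 0 0), (v 0 1) | by exists (v 0 2%:R) |].
  by apply: b1_rowP; rewrite !mxE /= !mulr0 !mulr1 !addr0 !add0r.
move=> [p q] [Ap Bq ->].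
have /= p2 := (b1_partP false p).1 Ap.
have /= [q0 q1] := (b1_partP true q).1 Bq.
congr pair;
  apply: b1_rowP; rewrite !mxE /= ?p2 ?q0 ?q1 ?mulr0 ?mulr1 ?addr0 ?add0r.
all: by [].
Qed.

Definition b1_space (K : numFieldType) : superspace K :=
  Superspace (@b1_part_subspace K) (@b1_part_direct K).

Lemma b1_bracket_bilinear (K : numFieldType) :
  bilinear_for *:%R *:%R (@b1_bracket K).
Proof. by split=> z a x y; apply: b1_rowP; rewrite !mxE /=; split; ring. Qed.

Lemma b1_bracket_part (K : numFieldType) i j (x y : 'rV[K]_3) :
  b1_part K i x -> b1_part K j y -> b1_part K (i (+) j) (b1_bracket x y).
Proof.
move=> /b1_partP Hx /b1_partP Hy; apply/b1_partP.
by case: i j Hx Hy => [] [] /= Hx Hy; rewrite !mxE /=;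
  rewrite ?Hx ?Hy ?(proj1 Hx) ?(proj2 Hx) ?(proj1 Hy) ?(proj2 Hy); try split; ring.
Qed.

Lemma b1_bracket_skew (K : numFieldType) i j (x y : 'rV[K]_3) :
  b1_part K i x -> b1_part K j y ->
  b1_bracket x y = - ((-1) ^+ (i && j) *: b1_bracket y x).
Proof.
move=> /b1_partP Hx /b1_partP Hy; apply: b1_rowP.
by case: i j Hx Hy => [] [] /= Hx Hy; rewrite !mxE /=;
  rewrite ?Hx ?Hy ?(proj1 Hx) ?(proj2 Hx) ?(proj1 Hy) ?(proj2 Hy); split; ring.
Qed.

Lemma b1_bracket_jacobi (K : numFieldType) i j (x y z : 'rV[K]_3) :
  b1_part K i x -> b1_part K j y ->
  b1_bracket x (b1_bracket y z) =
  b1_bracket (b1_bracket x y) z + (-1) ^+ (i && j) *: b1_bracket y (b1_bracket x z).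
Proof.
move=> /b1_partP Hx /b1_partP Hy; apply: b1_rowP.
by case: i j Hx Hy => [] [] /= Hx Hy; rewrite !mxE /=;
  rewrite ?Hx ?Hy ?(proj1 Hx) ?(proj2 Hx) ?(proj1 Hy) ?(proj2 Hy); split; field.
Qed.

Definition b1 (K : numFieldType) : lieSuperalgebra K :=
  @LieSuperalgebra K (b1_space K) (@b1_bracket K) (@b1_bracket_bilinear K)
    (@b1_bracket_part K) (@b1_bracket_skew K) (@b1_bracket_jacobi K).

Definition G_image (K : numFieldType) (M : superModule (b1 K)) (U : set M) :
  set M := [set act (b1_G K : b1 K) u | u in U].

Definition is_U_plus_GU (K : numFieldType) (M : superModule (b1 K))
    (U : set M) : Prop :=
  [/\ U `<=` part false, is_simple_even_submodule U &
      is_direct_sum U (G_image U)].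

(* Main.v *)
From HB Require Import structures.
Require Import Defs.
From mathcomp Require Import all_boot all_order all_algebra.
From mathcomp Require Import all_classical reals complex.

Set Implicit Arguments.
Unset Strict Implicit.
Unset Printing Implicit Defensive.

Import GRing.Theory Num.Theory.

Local Open Scope classical_set_scope.
Local Open Scope ring_scope.

(** The idea is that a simple module is generated by any nonzero even vector
subspace that the even part of the algebra preserves.  Write G for the odd
generator.  Since [x, G] is a multiple of G for every even x, and G acts with
square L_1, the sum W + G W is a graded submodule whenever W is a subspace of
the even part V_0 of V that is stable under L_0 and L_1
([submodule_generated]).

If V is simple and V_0 is nonzero, then W + G W is 0 or V.  As G W is odd, its
even part is exactly W, so W is 0 or V_0: hence V_0 is simple.  For W = V_0
the sum is all of V, so V_1 = G V_0 and V is the direct sum of V_0 and G V_0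
([simple_even_plus_G]).  If V_0 = 0, the parity change of V is concentrated in
even degree, and the same argument applies to it.

If moreover G U = 0, then the module is U, and L_1, being the square of G, acts
by 0.  What remains is a single operator L_0 without proper nonzero stable
subspace.  Over an algebraically closed field it has an eigenvector, hence it
is a scalar, and the space is a line ([irreducible_operator_one_dimensional]). *)

(** * Subspaces and bilinear actions *)

Section Subspace.
Context {K : numFieldType} {V : lmodType K} {A : set V}.
Hypothesis subA : is_subspace A.

Lemma subspace0 : A 0.
Proof. by case: subA; rewrite inE. Qed.

Lemma subspace_lin a u v : A u -> A v -> A (a *: u + v).
Proof. by case: subA => _ /(_ a u v); rewrite !inE; apply. Qed.

Lemma subspaceZ a u : A u -> A (a *: u).
Proof.
by move=> Au; rewrite -[_ *: _]addr0; apply: subspace_lin => //; apply: subspace0.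
Qed.

Lemma subspace_neq0 : A <> [set 0] -> exists2 v, A v & v != 0.
Proof.
move=> An0; apply: contrapT => no; apply: An0; rewrite eqEsubset; split => v /=.
  by move=> Av; apply/eqP/negP => /negP v0; apply: no; exists v.
by move=> ->; apply: subspace0.
Qed.

End Subspace.

Lemma mk_subspace (K : numFieldType) (V : lmodType K) (A : set V) :
  A 0 -> (forall a u v, A u -> A v -> A (a *: u + v)) -> is_subspace A.
Proof. by move=> A0 Al; split=> [|a u v]; rewrite !inE //; apply: Al. Qed.

Section Action.
Context {K : numFieldType} {L : lieSuperalgebra K} {V : superModule L}.

Lemma act_linear (x : L) : linear (@act K L V x).
Proof. by case: (act_bilinear V) => _ h a u v; apply: h. Qed.

Lemma act_linear_l (v : V) a (x y : L) :
  act (a *: x + y) v = a *: act x v + act y v.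
Proof. by case: (act_bilinear V) => h _; apply: h. Qed.

HB.instance Definition _ (x : L) :=
  GRing.isLinear.Build K V V *:%R (@act K L V x) (act_linear x).

Lemma act0 (x : L) : act x (0 : V) = 0.
Proof. exact: linear0. Qed.

Lemma actD (x : L) (u v : V) : act x (u + v) = act x u + act x v.
Proof. exact: linearD. Qed.

Lemma actZl (v : V) a (x : L) : act (a *: x) v = a *: act x v.
Proof.
have act0l : act (0 : L) v = 0.
  have := act_linear_l v 1 0 0; rewrite !scale1r addr0 => e.
  by apply: (addrI (act (0 : L) v)); rewrite -e addr0.
by rewrite -[a *: x]addr0 act_linear_l act0l addr0.
Qed.

End Action.

Lemma part_ex (K : numFieldType) (V : superspace K) (v : V) :
  exists a b, [/\ part false a, part true b & v = a + b].
Proof. by have [[a b] [[/= ? ? ?] _]] := part_direct v; exists a, b. Qed.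

Lemma part_uniq (K : numFieldType) (V : superspace K) (a b c d : V) :
  part false a -> part true b -> part false c -> part true d ->
  a + b = c + d -> a = c /\ b = d.
Proof.
move=> a0 b1 c0 d1 e; have [p [_ u]] := part_direct (a + b).
have pab : p = (a, b) by apply: u; split.
have pcd : p = (c, d) by apply: u; split.
by move: pab; rewrite pcd => -[-> ->].
Qed.

(** * Even parts of modules over the superalgebra *)

Section EvenPart.
Context {K : numFieldType} {V : superModule (b1 K)}.
Local Notation G := (b1_G K : b1 K).

Lemma part_G : part true G.
Proof. by exists 1; rewrite scale1r. Qed.

Lemma part_L1 : part false (b1_L1 K : b1 K).
Proof. by exists 0, 1; rewrite scale0r scale1r add0r. Qed.

Lemma act_GG (v : V) : act G (act G v) = act (b1_L1 K : b1 K) v.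
Proof.
have := act_bracket v part_G part_G.
have -> : bracket G G = 2 *: (b1_L1 K : b1 K) by have [[]] := b1_bracketE K.
rewrite expr1 scaleN1r opprK -mulr2n -scaler_nat actZl.
by apply: scalerI; rewrite pnatr_eq0.
Qed.

(** The bracket of an even element with G is odd, hence a multiple of G: even
elements move past G at the cost of a term in the image of G. *)
Lemma act_even_G (x : b1 K) : part false x ->
  exists c, forall v : V, act x (act G v) = act G (act x v) + c *: act G v.
Proof.
move=> x0; have [c e] := bracket_part x0 part_G; exists c => v.
have := act_bracket v x0 part_G; rewrite e actZl expr0 scale1r => <-.
by rewrite addrC subrK.
Qed.

(** Even elements move past G by [act_even_G], and G exchanges the two summands
because its square [L_1] is even and so preserves [W]. *)
Lemma submodule_generated (W : set V) :
  W `<=` part false -> stable_subspace (part false) W ->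
  is_submodule [set v | exists a b, [/\ W a, W b & v = a + act G b]].
Proof.
move=> We [subW Wst]; set S := [set v | _]; have W0 := subspace0 subW.
have subS : is_subspace S.
  apply: mk_subspace; first by exists 0, 0; rewrite act0 addr0.
  move=> c _ _ [a [b [Wa Wb ->]]] [a' [b' [Wa' Wb' ->]]].
  exists (c *: a + a'), (c *: b + b'); split; try exact: subspace_lin.
  by rewrite act_linear scalerDr addrACA.
split.
  move=> _ [a [b [Wa Wb ->]]]; exists a, (act G b); split=> //; split.
  - by exists a, 0; rewrite act0 addr0.
  - exact: We.
  - by exists 0, b; rewrite add0r.
  - by apply: (act_part part_G) (We _ Wb).
split=> // x _ _ [a [b [Wa Wb ->]]].
have [e [o [e0 [c ->] ->]]] := part_ex x.
rewrite addrC act_linear_l; apply: subspace_lin => //.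
  exists (act (b1_L1 K : b1 K) b), a; split=> //.
    by apply: Wst => //; exact: part_L1.
  by rewrite actD act_GG addrC.
have [d ed] := act_even_G e0.
exists (act e a), (d *: b + act e b); split; first exact: Wst.
  by apply: subspace_lin => //; apply: Wst.
by rewrite actD ed act_linear (addrC (act G _)).
Qed.

(** Every stable [W] inside the even part generates 0 or everything; the even
part itself is one such [W], which is why its image under G is the whole odd
part. *)
Lemma simple_even_plus_G : is_simple V -> part false <> [set 0 : V] ->
  is_U_plus_GU (part false : set V).
Proof.
move=> [_ Vs] V0n0; have subV0 := part_subspace V false.
have stV0 : stable_subspace (part false) (part false : set V).
  by split=> // x w x0 w0; apply: (act_part x0 w0).
have dich (W : set V) : W `<=` part false ->
    stable_subspace (part false) W -> W = [set 0] \/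
    forall v : V, exists a b, [/\ W a, W b & v = a + act G b].
  move=> We Wst; have subW := Wst.1; have W0 := subspace0 subW.
  case: (Vs _ (submodule_generated We Wst)) => eS; [left|right].
    rewrite eqEsubset; split=> [v Wv|_ ->] //; rewrite -eS.
    by exists v, 0; rewrite act0 addr0.
  by move=> v; have : [set: V] v by []; rewrite -eS.
have oddG (b : V) : part false b -> part true (act G b).
  by move=> b0; apply: (act_part part_G b0).
split=> //.
  split=> // W We Wst; case: (dich W We Wst) => [|gen]; [by left|right].
  rewrite eqEsubset; split=> // v v0; have [a [b [Wa Wb e]]] := gen v.
  (* The odd component of v vanishes, so v is its component in W. *)
  have [-> //] : v = a /\ 0 = act G b.
  apply: part_uniq => //; last by rewrite addr0.
  - exact: (subspace0 (part_subspace V true)).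
  - exact: We.
  - exact/oddG/We.
case: (dich _ (@subset_refl _ _) stV0) => // gen v.
have [a [b [a0 b0 ->]]] := gen v.
exists (a, act G b); split; first by split=> //; exists b.
move=> [c _] [/= c0 [d d0 <-] e].
by have [-> ->] := part_uniq a0 (oddG _ b0) c0 (oddG _ d0) e.
Qed.

End EvenPart.

Lemma parity_change_simple (K : numFieldType) (L : lieSuperalgebra K)
  (V : superModule L) : is_simple V -> is_simple (parity_change V).
Proof.
move=> [Vn0 Vs]; split=> // W [Wgr Wst]; apply: Vs; split=> // w /Wgr.
by move=> [w0 [w1 [h0 h1 e]]]; exists w1, w0; rewrite addrC.
Qed.

Lemma isomorphic_refl (K : numFieldType) (L : lieSuperalgebra K)
  (V : superModule L) : isomorphic V V.
Proof. by exists idfun; split=> //; exists idfun. Qed.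

(** * Operators without stable subspaces *)

Section Operator.
Context {K : numClosedFieldType} {M : lmodType K} (T : {linear M -> M}).

Definition poly_act (p : {poly K}) (v : M) : M :=
  \sum_(i < size p) p`_i *: iter i T v.

(** The bound of the sum is immaterial, so that polynomials of different sizes
can be combined. *)
Lemma poly_act_widen n (p : {poly K}) v : (size p <= n)%N ->
  poly_act p v = \sum_(i < n) p`_i *: iter i T v.
Proof.
move=> le; rewrite /poly_act (big_ord_widen n (fun i => p`_i *: iter i T v)) //.
rewrite big_mkcond; apply: eq_bigr => i _; case: ltnP => // le'.
by rewrite nth_default // scale0r.
Qed.

Lemma poly_act_lin a p q v :
  poly_act (a *: p + q) v = a *: poly_act p v + poly_act q v.
Proof.
pose n := maxn (size (a *: p + q)) (maxn (size p) (size q)).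
rewrite !(@poly_act_widen n) ?leq_max ?leqnn ?orbT //.
rewrite scaler_sumr -big_split; apply: eq_bigr => i _ /=.
by rewrite coefD coefZ scalerDl scalerA.
Qed.

Lemma poly_actMX p v : poly_act (p * 'X) v = poly_act p (T v).
Proof.
rewrite (@poly_act_widen (size p).+1); last first.
  by rewrite (leq_trans (size_polyMleq _ _)) // size_polyX addn2.
rewrite big_ord_recl coefMX scale0r add0r; apply: eq_bigr => i _.
by rewrite coefMX lift0 iterSr.
Qed.

Lemma poly_act_T p v : poly_act p (T v) = T (poly_act p v).
Proof.
by rewrite linear_sum; apply: eq_bigr => i _; rewrite linearZ -iterSr.
Qed.

Lemma poly_act_linr p a u v :
  poly_act p (a *: u + v) = a *: poly_act p u + poly_act p v.
Proof.
rewrite scaler_sumr -big_split; apply: eq_bigr => i _ /=.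
have -> : iter i T (a *: u + v) = a *: iter i T u + iter i T v.
  by elim: (nat_of_ord i) => //= n ->; rewrite linearP.
by rewrite scalerDr !scalerA mulrC.
Qed.

Lemma poly_actC c v : poly_act c%:P v = c *: v.
Proof.
by rewrite (@poly_act_widen 1) ?size_polyC_leq1 // big_ord1 coefC.
Qed.

(** If a product of linear factors kills a nonzero vector, then peeling off the
factors one at a time meets an eigenvector. *)
Lemma eigenvector_of_factors c (s : seq K) v : c != 0 -> v != 0 ->
  poly_act (c *: \prod_(a <- s) ('X - a%:P)) v = 0 ->
  exists a w, w != 0 /\ T w = a *: w.
Proof.
move=> c0; elim: s v => [|a s IH] v v0.
  rewrite big_nil -mul_polyC mulr1 poly_actC => /eqP.
  by rewrite scaler_eq0 (negPf c0) (negPf v0).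
rewrite big_cons mulrC scalerAl => e.
have [/eqP Tv|n0] := boolP (T v - a *: v == 0).
  by exists a, v; split=> //; apply/eqP; rewrite -subr_eq0 Tv.
apply: (IH _ n0); rewrite -e; set p := c *: _.
have -> : p * ('X - a%:P) = (- a) *: p + p * 'X.
  by rewrite mulrBr [p * a%:P]mulrC mul_polyC scaleNr addrC.
by rewrite poly_act_lin poly_actMX -poly_act_linr scaleNr addrC.
Qed.

Hypothesis Tirr : forall W : set M, is_subspace W ->
  (forall w, W w -> W (T w)) -> W = [set 0] \/ W = setT.

(** Either [T v = 0], or the vectors [p(T) (T v)] form a nonzero stable
subspace, which therefore contains [v]; then a polynomial with constant term
[-1], hence nonzero, kills [v]. *)
Lemma irreducible_operator_eigenvector (v : M) : v != 0 ->
  exists a w, w != 0 /\ T w = a *: w.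
Proof.
move=> v0; have [/eqP Tv|Tv] := boolP (T v == 0).
  by exists 0, v; rewrite scale0r.
pose W := [set w | exists p, w = poly_act p (T v)].
have subW : is_subspace W.
  apply: mk_subspace; first by exists 0; rewrite -polyC0 poly_actC scale0r.
  by move=> a _ _ [p ->] [q ->]; exists (a *: p + q); rewrite poly_act_lin.
have Wst w : W w -> W (T w).
  by move=> [p ->]; exists (p * 'X); rewrite poly_actMX -poly_act_T.
case: (Tirr subW Wst) => eW.
  have : W (T v) by exists 1; rewrite -polyC1 poly_actC scale1r.
  by rewrite eW /= => e; rewrite e eqxx in Tv.
have [p ep] : W v by rewrite eW.
pose q := p * 'X + (-1)%:P.
have q0 : q != 0.
  apply/eqP => /(congr1 (fun r : {poly K} => r`_0)).
  by rewrite coefD coefMX coefC coef0 add0r; apply/eqP; rewrite oppr_eq0 oner_eq0.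
have [s es] := closed_field_poly_normal q.
apply: (eigenvector_of_factors (c := lead_coef q) (s := s)) v0 _.
  by rewrite lead_coef_eq0.
rewrite -es /q -[p * 'X]scale1r poly_act_lin scale1r poly_actMX -ep poly_actC.
by rewrite scaleN1r subrr.
Qed.

(** The eigenspace is stable, so the operator is a scalar; then every line is
stable. *)
Lemma irreducible_operator_one_dimensional (v : M) : v != 0 -> one_dimensional M.
Proof.
move=> /irreducible_operator_eigenvector [a [w [w0 Tw]]]; exists w => //.
have line_sub : is_subspace [set u | exists c, u = c *: w].
  apply: mk_subspace; first by exists 0; rewrite scale0r.
  move=> b _ _ [c ->] [d ->]; exists (b * c + d).
  by rewrite scalerDl scalerA.
case: (Tirr line_sub) => [_ [c ->]|e|e u].
- by exists (c * a); rewrite linearZZ Tw scalerA.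
- have : [set u | exists c, u = c *: w] w by exists 1; rewrite scale1r.
  by rewrite e /= => w_eq0; rewrite w_eq0 eqxx in w0.
- by have : [set: M] u by []; rewrite -e.
Qed.

End Operator.

(** * Vanishing of G and parity change *)

Lemma one_dimensional_bij (K : numFieldType) (V M : lmodType K)
  (f : {linear V -> M}) : bijective f -> one_dimensional M -> one_dimensional V.
Proof.
move=> [g fK gK] [v v0 span]; exists (g v).
  by apply: contra v0 => /eqP e; rewrite -(gK v) e linear0.
by move=> w; have [c e] := span (f w); exists c; rewrite -(fK w) e -(gK v) -linearZ !fK.
Qed.

Lemma one_dimensional_of_G_trivial (K : numClosedFieldType)
  (M : superModule (b1 K)) (U : set M) :
  is_U_plus_GU U -> G_image U = [set 0] -> one_dimensional M.
Proof.
move=> [_ [[subU Ust] Un0 Us] dir] GU0.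
have UT : U = [set: M].
  rewrite eqEsubset; split=> // v _; have [[a b] [[/= Ua]]] := dir v.
  by rewrite GU0 => /= -> ->; rewrite addr0.
have G0 (v : M) : act (b1_G K : b1 K) v = 0.
  have : G_image U (act (b1_G K : b1 K) v) by exists v => //; rewrite UT.
  by rewrite GU0.
have [v _ v0] := subspace_neq0 subU Un0.
pose L0 := b1_L0 K : b1 K.
apply: (irreducible_operator_one_dimensional (T := act L0)) v0 => W subW Wst.
rewrite -UT; apply: Us; first by rewrite UT.
split=> // _ w [a [b ->]] Ww.
rewrite act_linear_l actZl -act_GG !G0 scaler0 addr0.
by apply: subspaceZ => //; apply: Wst.
Qed.

Theorem proposition5p1 (R : realType) (V : superModule (b1 R[i]))
    (Vsimple : is_simple V) :
  (exists (M : superModule (b1 R[i])) (U : set M),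
     is_U_plus_GU U /\ isomorphic_up_to_parity V M) /\
  (forall (M : superModule (b1 R[i])) (U : set M),
     is_U_plus_GU U -> isomorphic_up_to_parity V M ->
     G_image U = [set 0] -> one_dimensional V).
Proof.
split.
  have [V00|V0n0] := pselect (part false = [set 0 : V]); last first.
    exists V, (part false); split; first exact: simple_even_plus_G.
    by left; apply: isomorphic_refl.
  exists (parity_change V), (part false); split; last first.
    by right; apply: isomorphic_refl.
  apply: simple_even_plus_G; first exact: parity_change_simple.
  move=> V10; apply: Vsimple.1; rewrite eqEsubset; split=> [v _|//].
  have [a [b [a0 b1 ->]]] := part_ex v.
  move: a0; rewrite V00 => /= ->.
  by have : [set (0 : V)] b; [rewrite -V10 | move=> /= ->; rewrite addr0].
move=> M U MU iso GU0; have M1 := one_dimensional_of_G_trivial MU GU0.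
by case: iso => [[f [fbij _ _]]|[f [fbij _ _]]];
  apply: (one_dimensional_bij fbij M1).
Qed.
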